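(* Let $\Omega=\{1,2,3\}^{\mathbb N}$ with the shift $\sigma$, and let $A:\Omega\to\mathbb R$ be the potential depending only on the first two coordinates given by $A(x)=-\varepsilon_{x_0x_1}$, where $\varepsilon_{11}=\varepsilon_{22}=0$ and $\varepsilon_{ij}>0$ for every other pair $(i,j)\in\{1,2,3\}^2$. Let $\mathcal P(\beta)$ be the pressure of $\beta A$, let $\rho=-\lim_{\beta\to+\infty}\frac1\beta\log\mathcal P(\beta)$, and let $g(\beta)=\mathcal P(\beta)e^{\rho\beta}$. Then the function $g$ admits a (finite) limit as $\beta\to+\infty$.
   Context: $\sigma(x_0x_1x_2\ldots)=x_1x_2\ldots$. The pressure is $\mathcal P(\beta)=\sup_\mu\{h_\mu+\beta\int A\,d\mu\}$ over $\sigma$-invariant Borel probability measures $\mu$ on $\Omega$, with $h_\mu$ the Kolmogorov(-Sinai) entropy; equivalently $e^{\mathcal P(\beta)}$ is the spectral radius of the $3\times3$ matrix with entries $e^{-\beta\varepsilon_{ij}}$. The limit defining $\rho$ exists and $\rho$ is a positive real number, so $g$ is a positive function with $\frac1\beta\log g(\beta)\to0$ as $\beta\to+\infty$. *)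

(* Defs.v *)
From HB Require Import structures.
From mathcomp Require Import all_boot all_order all_algebra.
From mathcomp Require Import all_classical all_reals all_analysis.

Set Implicit Arguments.
Unset Strict Implicit.
Unset Printing Implicit Defensive.

Import Order.TTheory GRing.Theory Num.Theory.
Import numFieldNormedType.Exports.

Local Open Scope classical_set_scope.
Local Open Scope ring_scope.

Section entropy.
Context (R : realType) (d : measure_display) (T : measurableType d).
Implicit Types (f : T -> T) (mu : probability T R).

Definition invariant_measure f mu :=
  forall B : set T, measurable B -> mu (f @^-1` B) = mu B.

(* A finite measurable partition of T is encoded by its labelling
   xi : T -> 'I_k; its atoms are the fibres of xi (some may be empty). *)
Definition measurable_partition k (xi : T -> 'I_k) :=
  forall a : 'I_k, measurable (xi @^-1` [set a]).

(* The atoms of xi \/ f^-1 xi \/ ... \/ f^-(n-1) xi, indexed by words. *)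
Definition join_atom f k (xi : T -> 'I_k) n (w : {ffun 'I_n -> 'I_k}) : set T :=
  [set x | forall i : 'I_n, xi (iter i f x) = w i].

(* The convention 0 log 0 = 0 holds here by 0 * _ = 0. *)
Definition join_entropy f mu k (xi : T -> 'I_k) n : R :=
  - \sum_(w : {ffun 'I_n -> 'I_k})
      fine (mu (join_atom f xi w)) * ln (fine (mu (join_atom f xi w))).

Definition partition_entropy f mu k (xi : T -> 'I_k) : R :=
  lim (join_entropy f mu xi n / n%:R @[n --> \oo]).

Definition KS_entropy f mu : \bar R :=
  ereal_sup [set h | exists k (xi : T -> 'I_k),
    measurable_partition xi /\ h = (partition_entropy f mu xi)%:E].

End entropy.

(* The symbols 1, 2, 3 are the elements 0, 1, 2 of 'I_3. *)
Definition symbol : Type := discrete_topology 'I_3.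
HB.instance Definition _ := DiscreteTopology.on symbol.
HB.instance Definition _ := isPointed.Build symbol (ord0 : 'I_3).

Definition sequence3 : Type := prod_topology (fun _ : nat => symbol).
HB.instance Definition _ := Pointed.on sequence3.
HB.instance Definition _ := Topological.on sequence3.

(* The sequence space with its Borel sigma-algebra. *)
Notation Omega := (g_sigma_algebraType (@open sequence3)).

Definition left_shift (x : Omega) : Omega := fun n => x n.+1.

Section pressure.
Context (R : realType).

Definition potential (eps : 'I_3 -> 'I_3 -> R) (x : Omega) : R :=
  - eps (x 0%N) (x 1%N).

(* The pressure of beta A.  The supremum is taken in \bar R; it is finite for
   a bounded measurable A, the entropy of the shift being at most log 3. *)
Definition pressure (A : Omega -> R) (beta : R) : R :=
  fine (ereal_sup
    [set (KS_entropy left_shift mu + beta%:E * \int[mu]_x (A x)%:E)%E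
       | mu in [set mu : probability Omega R | invariant_measure left_shift mu]]).

Definition pressure_rate (A : Omega -> R) : R :=
  - lim (beta^-1 * ln (pressure A beta) @[beta --> +oo]).

Definition pressure_prefactor (A : Omega -> R) (beta : R) : R :=
  pressure A beta * expR (pressure_rate A * beta).

End pressure.

(* Main.v *)
(* Write [a i j = exp (- beta eps_ij)].  The variational principle identifies
   the pressure with [ln (1 + m)], where [1 + m] is the Perron eigenvalue of the
   matrix [a]:
   - The Parry measure attains this value.  It is obtained as the image of
     Lebesgue measure on [0, 1[ under the coding by nested intervals.
   - For the upper bound, a finite partition [xi] agrees, up to a set of small
     measure, with a function of finitely many coordinates.  Gibbs' inequality,
     applied to the joint distribution of the [xi]-name and of a symbol word,
     then bounds the entropy without any recourse to conditional entropies.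
   The characteristic equation reads
     (m^2 - a12 a21) (1 + m - a33) =
       m (a13 a31 + a23 a32) + a12 a23 a31 + a13 a21 a32.
   Let [rho] be the least of the rates of [a13 a31], [a23 a32] and of half the
   rates of the other three products.  Then [x = m exp (rho beta)] is the
   positive root of [x^2 = B x + C], where [B] and [C] converge as [beta] tends
   to infinity and their limits are not both zero. *)

Require Import Defs.
From HB Require Import structures.
From mathcomp Require Import all_boot all_order all_algebra.
From mathcomp Require Import all_classical all_reals all_analysis.
From mathcomp Require Import ring lra zify.

Set Implicit Arguments.
Unset Strict Implicit.
Unset Printing Implicit Defensive.

Import Order.TTheory GRing.Theory Num.Theory.
Import numFieldNormedType.Exports.

Local Open Scope classical_set_scope.
Local Open Scope ring_scope.

(** * Cylinders and the Borel sets of the sequence space *)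

Definition agree (m : nat) (x y : sequence3) : Prop :=
  forall i, (i < m)%N -> y i = x i.

Definition agree_filter (x : sequence3) : set_system sequence3 :=
  [set A | exists m, forall y, agree m x y -> A y].

Lemma agree_filter_filter x : Filter (agree_filter x).
Proof.
split; first by exists 0%N.
- move=> A B [m mA] [n nB]; exists (maxn m n) => y xy; split.
  + by apply: mA => i im; apply: xy; rewrite leq_max im.
  + by apply: nB => i im; apply: xy; rewrite leq_max im orbT.
- by move=> A B AB [m mA]; exists m => y /mA/AB.
Qed.

(** Forwards, the filter of cylinders around [x] converges to [x] because it does so in each
    coordinate: fixing [i.+1] symbols fixes the one of index [i]. Backwards, a cylinder is a finite
    intersection of preimages of points under projections to a discrete space. *)
Lemma open_agreeP (U : set sequence3) :
  open U <-> forall x, U x -> exists m, forall y, agree m x y -> U y.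
Proof.
split=> [oU x Ux|h].
  have FF := agree_filter_filter x.
  suff : agree_filter x --> x.
    by apply; move: oU; rewrite openE => /(_ x Ux).
  apply/cvg_sup => i.
  apply/cvg_image; first by apply/seteqP; split=> // a _; exists (fun=> a).
  move=> A; rewrite nbhs_principalE => Ax.
  exists (@proj nat (fun=> symbol) i @^-1` A); last first.
    by apply/seteqP; split=> [a [y]|a Aa]; [by move=> ? <- | exists (fun=> a)].
  by exists i.+1 => y /(_ i (ltnSn i)) xy; rewrite /= /proj xy; apply: Ax.
rewrite openE => x /h [m mU]; rewrite /interior.
have : nbhs x [set y | agree m x y].
  elim: m {mU} => [|m IH]; first by apply: filterS filterT => y _ i.
  have : nbhs x (@proj nat (fun=> symbol) m @^-1` [set x m]).
    by apply: (@proj_continuous nat (fun=> symbol) m x); rewrite nbhs_principalE.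
  move=> xm; apply: filterS (filterI IH xm) => y [/= a1 a2] i.
  by rewrite ltnS leq_eqVlt => /predU1P[->//|/a1].
exact: filterS.
Qed.

Lemma agree_refl m x : agree m x x. Proof. by []. Qed.

Lemma agree_sym m x y : agree m x y -> agree m y x.
Proof. by move=> xy i im; rewrite xy. Qed.

Lemma agree_trans m x y z : agree m x y -> agree m y z -> agree m x z.
Proof. by move=> xy yz i im; rewrite yz// xy. Qed.

Lemma agree_le m n x y : (m <= n)%N -> agree n x y -> agree m x y.
Proof. by move=> mn xy i im; apply: xy; apply: leq_trans mn. Qed.

(** Serves for labellings and, with [Y := Prop], for sets, which are then unions of cylinders of
    length [m]. *)
Definition determined (Y : Type) (m : nat) (f : Omega -> Y) : Prop :=
  forall x y, agree m x y -> f y = f x.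

Lemma determined_le (Y : Type) m n (f : Omega -> Y) :
  (m <= n)%N -> determined m f -> determined n f.
Proof. by move=> mn fm x y xy; apply: fm; exact: agree_le xy. Qed.

Lemma measurable_open (U : set Omega) : open (U : set sequence3) -> measurable U.
Proof. exact: sub_sigma_algebra. Qed.

Lemma determined_measurable m (A : set Omega) : determined m A -> measurable A.
Proof.
move=> dA; apply: measurable_open; apply/open_agreeP => x Ax.
by exists m => y /dA ->.
Qed.

(** The largest union of cylinders of length [m] inside [U]; these sets increase to [U] when [U] is
    open. *)
Definition inner (U : set Omega) (m : nat) : set Omega :=
  [set x | forall y, agree m x y -> U y].

Lemma determined_inner U m : determined m (inner U m).
Proof.
move=> x y xy; apply/propext; split=> h z.
  by move=> xz; apply: h; apply: agree_trans xz; exact: agree_sym.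
by move=> yz; apply: h; exact: agree_trans yz.
Qed.

Lemma inner_nondecreasing U : {homo inner U : m n / (m <= n)%N >-> (m <= n)%O}.
Proof. by move=> m n mn; apply/subsetPset => x h y xy; apply: h; exact: agree_le xy. Qed.

Lemma bigcup_inner (U : set Omega) :
  open (U : set sequence3) -> \bigcup_m inner U m = U.
Proof.
move=> /open_agreeP oU; apply/seteqP; split=> [x [m _]|x /oU[m mU]].
  by apply; exact: agree_refl.
by exists m.
Qed.

Lemma measurable_left_shift : measurable_fun setT left_shift.
Proof.
apply: (@measurability _ _ Omega Omega _ _ (@open sequence3)) => //.
move=> _ [U oU <-]; rewrite setTI; apply: measurable_open; apply/open_agreeP.
move=> x; move/open_agreeP : oU => oU /oU[m mU]; exists m.+1 => y xy.
by apply: mU => i im; exact: xy.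
Qed.

Lemma iter_left_shift n (x : Omega) i : iter n left_shift x i = x (i + n)%N.
Proof.
by elim: n i => [|n IH] i /=; rewrite ?addn0// /left_shift IH addSnnS.
Qed.

(** * Laws of finite-valued maps *)

Section finite_valued.
Context (R : realType) (d : measure_display) (T : measurableType d).
Implicit Types (P : probability T R) (F G : finType).

Definition mfinite F (X : T -> F) := forall a, measurable (X @^-1` [set a]).

Lemma mfinite_preimage F (X : T -> F) (A : set F) :
  mfinite X -> measurable (X @^-1` A).
Proof.
move=> mX; have -> : X @^-1` A = \bigcup_(a in A) X @^-1` [set a].
  by apply/seteqP; split=> [x Ax|x [a Aa /= ->]//]; exists (X x).
exact: fin_bigcup_measurable finite_finset _.
Qed.

Lemma mfinite_pair F G (X : T -> F) (Y : T -> G) :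
  mfinite X -> mfinite Y -> mfinite (fun x => (X x, Y x)).
Proof.
move=> mX mY [a b].
have -> : (fun x => (X x, Y x)) @^-1` [set (a, b)] =
    X @^-1` [set a] `&` Y @^-1` [set b].
  by apply/seteqP; split=> x /= [-> ->].
by apply: measurableI.
Qed.

Lemma mfinite_ffun (I : finType) F (X : I -> T -> F) :
  (forall i, mfinite (X i)) -> mfinite (fun x => [ffun i => X i x]).
Proof.
move=> mX w.
have -> : (fun x => [ffun i => X i x]) @^-1` [set w] =
    \bigcap_(i in [set: I]) X i @^-1` [set w i].
  apply/seteqP; split=> [x /= <- i _ /=|x h /=]; first by rewrite ffunE.
  by apply/ffunP => i; rewrite ffunE; exact: h.
by apply: fin_bigcap_measurable => // i _; exact: mX.
Qed.

Definition law P F (X : T -> F) (a : F) : R := fine (P (X @^-1` [set a])).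

Lemma law_ge0 P F (X : T -> F) a : 0 <= law P X a.
Proof. exact: fine_ge0. Qed.

Lemma lawE P F (X : T -> F) a : mfinite X -> P (X @^-1` [set a]) = (law P X a)%:E.
Proof. by move=> mX; rewrite fineK// fin_num_measure. Qed.

Lemma law_preimage P F (X : T -> F) (A : {pred F}) : mfinite X ->
  P (X @^-1` [set` A]) = (\sum_(a in A) law P X a)%:E.
Proof.
move=> mX; have -> : X @^-1` [set` A] = \bigcup_(a in [set` A]) X @^-1` [set a].
  by apply/seteqP; split=> [x Ax|x [a Aa /= ->]//]; exists (X x).
rewrite measure_fin_bigcup//; last by move=> a b _ _ [x [/= <- <-]].
rewrite -sumEFin -(@bigfs _ _ _ _ (index_enum F)) ?index_enum_uniq//=; last first.
  by move=> a _; rewrite mem_index_enum.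
by apply: eq_bigr => a _; rewrite lawE.
Qed.

Lemma sum_law P F (X : T -> F) : mfinite X -> \sum_a law P X a = 1.
Proof.
move=> mX; apply: EFin_inj.
rewrite -(law_preimage P predT mX) (_ : [set` predT] = setT); last first.
  by apply/seteqP; split.
by rewrite preimage_setT probability_setT.
Qed.

Lemma law_comp P F G (X : T -> F) (g : F -> G) b : mfinite X ->
  law P (g \o X) b = \sum_(a | g a == b) law P X a.
Proof.
move=> mX; have := law_preimage P [pred a | g a == b] mX.
rewrite (_ : X @^-1` _ = (g \o X) @^-1` [set b]); last first.
  by apply/seteqP; split=> x /= /eqP.
by rewrite /law => ->.
Qed.

Lemma expect_comp P F G (X : T -> F) (g : F -> G) (f : G -> R) : mfinite X ->
  \sum_b law P (g \o X) b * f b = \sum_a law P X a * f (g a).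
Proof.
move=> mX; rewrite [RHS](partition_big g xpredT)//=; apply: eq_bigr => b _.
rewrite law_comp// mulr_suml; apply: eq_bigr => a /eqP -> //.
Qed.

Lemma expect_integral P F (X : T -> F) (f : F -> R) : mfinite X ->
  (\int[P]_x (f (X x))%:E = (\sum_a law P X a * f a)%:E)%E.
Proof.
move=> mX.
transitivity (\int[P]_x (\sum_a (f a)%:E * (\1_(X @^-1` [set a]) x)%:E))%E.
  apply: eq_integral => x _; rewrite (bigD1 (X x))//= big1; last first.
    move=> a aX; rewrite indicE memNset ?mule0//= => E.
    by rewrite -E eqxx in aX.
  by rewrite indicE mem_set//= mule1 adde0.
have ii a : P.-integrable setT (EFin \o (\1_(X @^-1` [set a]) : T -> R)).
  by apply: integrable_indic => //; rewrite ltey_eq fin_num_measure.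
rewrite integral_sum//; last first.
  by move=> a; apply: integrableZl => //; exact: ii.
rewrite -sumEFin; apply: eq_bigr => a _.
rewrite integralZl//; last exact: ii.
by rewrite integral_indic// setIT muleC EFinM -(lawE P a mX).
Qed.

(* [ln y <= y - 1] applied to [q a / law P (g \o X) (g a)]; dividing by the law
   of [g \o X] rather than by that of [X] costs nothing, the latter being
   smaller. *)
Lemma gibbs P F G (X : T -> F) (g : F -> G) (q : F -> R) : mfinite X ->
  (forall a, 0 < q a) -> \sum_a q a <= 1 ->
  - \sum_b law P (g \o X) b * ln (law P (g \o X) b) <=
  - \sum_a law P X a * ln (q a).
Proof.
move=> mX q0 q1; rewrite expect_comp// lerN2 -subr_ge0 -sumrB.
apply: (@le_trans _ _ (\sum_a (law P X a - q a))).
  by rewrite sumrB sum_law// subr_ge0.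
apply: ler_sum => a _; rewrite -mulrBr.
have := law_ge0 P X a; rewrite le_eqVlt => /predU1P[<-|pa].
  by rewrite mul0r sub0r oppr_le0 ltW.
have pg : law P X a <= law P (g \o X) (g a).
  rewrite law_comp// (bigD1 a)//= lerDl sumr_ge0// => *; exact: law_ge0.
have pg0 := lt_le_trans pa pg.
rewrite -[leLHS](opprB (q a)) lerNl -mulrN opprB -ln_div ?posrE//.
apply: (@le_trans _ _ (law P X a * (q a / law P (g \o X) (g a) - 1))).
  rewrite ler_pM2l// -[in leLHS](subrK 1 (q a / _)) addrC.
  apply: le_ln1Dx.
  by rewrite ltrBrDl subrr divr_gt0.
rewrite mulrBr mulr1 lerB// mulrCA -ler_pdivlMl// mulVf ?gt_eqF//.
by rewrite ler_pdivrMr// mul1r.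
Qed.
End finite_valued.

(** * Markov measures *)

Lemma ord3P (a : 'I_3) : [\/ a = 0, a = 1 | a = 2].
Proof.
case: a => [[|[|[|//]]] i]; [apply: Or31|apply: Or32|apply: Or33]; exact: val_inj.
Qed.

Lemma sum3E (V : nmodType) (f : 'I_3 -> V) : \sum_a f a = f 0 + f 1 + f 2.
Proof.
rewrite !big_ord_recr big_ord0 /= add0r.
by congr (f _ + f _ + f _); exact: val_inj.
Qed.

Definition prefix3 m (x : Omega) : {ffun 'I_m -> 'I_3} := [ffun i : 'I_m => x i].

(** A chosen point of the cylinder of [u], at which functions determined by [m] coordinates can be
    evaluated. *)
Definition extend m (u : {ffun 'I_m -> 'I_3}) : Omega :=
  fun i => if insub i is Some j then u j else 0.

Lemma extendE m (u : {ffun 'I_m -> 'I_3}) (i : 'I_m) : extend u i = u i.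
Proof. by rewrite /extend valK. Qed.

Lemma agree_extend m u x : agree m (extend u) x <-> prefix3 m x = u.
Proof.
split=> [h|<- i im]; first by apply/ffunP => i; rewrite ffunE h// extendE.
by rewrite -[i]/(val (Ordinal im)) extendE ffunE.
Qed.

Lemma agree_prefix m x : agree m (extend (prefix3 m x)) x.
Proof. exact/agree_extend. Qed.

Lemma determined_prefix m : determined m (prefix3 m).
Proof. by move=> x y xy; apply/ffunP => i; rewrite !ffunE xy. Qed.

Lemma determined_mfinite m (F : finType) (X : Omega -> F) :
  determined m X -> mfinite X.
Proof.
move=> dX a; apply: (@determined_measurable m) => x y xy.
by rewrite /preimage /= (dX _ _ xy).
Qed.

Section unit_lebesgue.
Context (R : realType).

Definition unit_lebesgue : set (measurableTypeR R) -> \bar R :=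
  mrestr lebesgue_measure (measurable_itv (`[0, 1[%R : interval R)).
HB.instance Definition _ := Measure.on unit_lebesgue.

Let unit_lebesgueT : unit_lebesgue setT = 1%E.
Proof.
rewrite /unit_lebesgue /mrestr setTI lebesgue_measure_itv /= lte01.
by rewrite oppr0 adde0.
Qed.

HB.instance Definition _ :=
  Measure_isProbability.Build _ _ _ unit_lebesgue unit_lebesgueT.

End unit_lebesgue.

(** * Coding of real numbers by nested intervals *)

Section markov_coding.
Context (R : realType) (p0 : 'I_3 -> R) (Q : 'I_3 -> 'I_3 -> R).

(* A state is the left end and the length of an interval, together with the
   proportions in which it is about to be cut into three. *)
Let state : Type := (R * R * ('I_3 -> R))%type.

Definition cumul (p : 'I_3 -> R) (a : 'I_3) : R := \sum_(b < 3 | (b < a)%N) p b.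

Definition next (s : state) (a : 'I_3) : state :=
  (s.1.1 + s.1.2 * cumul s.2 a, s.1.2 * s.2 a, Q a).

(** Points outside the interval of [s] receive a digit as well, so that [coding] is defined on the
    whole line; only [[0, 1[] carries mass. *)
Definition digit (s : state) (t : R) : 'I_3 :=
  if t < s.1.1 + s.1.2 * s.2 0 then 0
  else if t < s.1.1 + s.1.2 * (s.2 0 + s.2 1) then 1 else 2.

(** [word_state] prescribes the digits while [point_state] reads them off [t]; the two agree along
    [coding t], which reduces the study of [coding] to words. *)
Fixpoint word_state (y : Omega) n : state :=
  if n is m.+1 then next (word_state y m) (y m) else (0, 1, p0).

Fixpoint point_state (t : R) n : state :=
  if n is m.+1 then let s := point_state t m in next s (digit s t)
  else (0, 1, p0).

Definition coding (t : measurableTypeR R) : Omega := fun n => digit (point_state t n) t.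

Lemma point_stateE t n : point_state t n = word_state (coding t) n.
Proof. by elim: n => //= n IH; rewrite -IH. Qed.

Lemma word_state_agree n x y : agree n x y -> word_state y n = word_state x n.
Proof.
elim: n => //= n IH xy; rewrite (xy n)// IH// => i im; apply: xy; exact: leqW.
Qed.

Lemma agree_codingS n y t : agree n.+1 y (coding t) <->
  agree n y (coding t) /\ digit (word_state y n) t = y n.
Proof.
split=> [h|[h1 h2] i].
  have h' : agree n y (coding t) by apply: agree_le h.
  split=> //; have := h n (ltnSn n).
  by rewrite {1}/coding point_stateE (word_state_agree h').
rewrite ltnS leq_eqVlt => /predU1P[->|/h1//].
by rewrite {1}/coding point_stateE (word_state_agree h1).
Qed.

(** The length of the interval of the word, which [word_weightS] identifies with the Markov weight
    of the cylinder. *)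
Definition word_weight (y : Omega) n : R := (word_state y n).1.2.

Lemma word_weightS y n :
  word_weight y n.+1 = p0 (y 0%N) * \prod_(i < n) Q (y i) (y i.+1).
Proof.
elim: n => [|n IH]; first by rewrite big_ord0 mulr1 /word_weight /= mul1r.
by rewrite big_ord_recr mulrA -IH.
Qed.

Lemma measurable_digit s a : measurable (digit s @^-1` [set a] : set (measurableTypeR R)).
Proof.
pose I1 : set (measurableTypeR R) := [set` `]-oo, (s.1.1 + s.1.2 * s.2 0)[%R].
pose I2 : set (measurableTypeR R) := [set` `]-oo, (s.1.1 + s.1.2 * (s.2 0 + s.2 1))[%R].
have m1 : measurable I1 by exact: measurable_itv.
have m2 : measurable I2 by exact: measurable_itv.
have e1 t : I1 t = (t < s.1.1 + s.1.2 * s.2 0) by rewrite /I1 /= in_itv.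
have e2 t : I2 t = (t < s.1.1 + s.1.2 * (s.2 0 + s.2 1)) by rewrite /I2 /= in_itv.
have [->|->|->] := ord3P a.
- rewrite (_ : _ @^-1` _ = I1)//; apply/seteqP; split=> t /=; rewrite e1 /digit.
    by case: ifP => // _; case: ifP.
  by move=> ->.
- rewrite (_ : _ @^-1` _ = ~` I1 `&` I2).
    by apply: measurableI => //; exact: measurableC.
  apply/seteqP; split=> t /=; rewrite e1 e2 /digit.
    by case: ifP => // _; case: ifP.
  by case=> /negP/negbTE -> ->.
- rewrite (_ : _ @^-1` _ = ~` I1 `&` ~` I2).
    by apply: measurableI => //; exact: measurableC.
  apply/seteqP; split=> t /=; rewrite e1 e2 /digit.
    by case: ifP => // _; case: ifP.
  by case=> /negP/negbTE -> /negP/negbTE ->.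
Qed.

Lemma measurable_agree_coding n y :
  measurable ([set t | agree n y (coding t)] : set (measurableTypeR R)).
Proof.
elim: n => [|n IH].
  by rewrite (_ : mkset _ = setT)//; apply/seteqP; split=> // t _ i.
rewrite (_ : mkset _ = [set t | agree n y (coding t)] `&`
    digit (word_state y n) @^-1` [set y n]).
  by apply: measurableI => //; exact: measurable_digit.
by apply/seteqP; split=> t /agree_codingS.
Qed.

Lemma mfinite_prefix_coding n : mfinite (prefix3 n \o coding : measurableTypeR R -> _).
Proof.
move=> u; rewrite (_ : _ @^-1` _ = [set t | agree n (extend u) (coding t)]).
  exact: measurable_agree_coding.
by apply/seteqP; split=> t /agree_extend.
Qed.

(** An open set is the countable union of its [inner] sets, each of which is a condition on finitely
    many digits. *)
Lemma measurable_coding : measurable_fun setT (coding : measurableTypeR R -> Omega).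
Proof.
apply: (@measurability _ _ (measurableTypeR R) Omega _ _ (@open sequence3)) => //.
move=> _ [U oU <-]; rewrite setTI -(bigcup_inner oU) preimage_bigcup.
apply: bigcup_measurable => m _.
rewrite (_ : _ @^-1` _ = (prefix3 m \o coding) @^-1` [set u | inner U m (extend u)]).
  by apply: mfinite_preimage; exact: mfinite_prefix_coding.
rewrite comp_preimage; congr (_ @^-1` _); apply/funext => x /=.
apply: (@determined_inner U m).
exact: agree_prefix.
Qed.

HB.instance Definition _ :=
  isMeasurableFun.Build _ _ (measurableTypeR R) Omega coding measurable_coding.

Hypotheses (p0_ge0 : forall a, 0 <= p0 a) (p0_sum : \sum_a p0 a = 1).
Hypotheses (Q_ge0 : forall a b, 0 <= Q a b) (Q_sum : forall a, \sum_b Q a b = 1).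

Lemma word_state_prob y n :
  (forall a, 0 <= (word_state y n).2 a) /\ \sum_a (word_state y n).2 a = 1.
Proof. by case: n => [|n]; split => //=; exact: Q_sum. Qed.

Lemma word_weight_ge0 y n : 0 <= word_weight y n.
Proof.
rewrite /word_weight; elim: n => //= n IH; apply: mulr_ge0 => //.
by have [] := word_state_prob y n.
Qed.

Lemma cumulE p : [/\ cumul p 0 = 0, cumul p 1 = p 0 & cumul p 2 = p 0 + p 1].
Proof.
by split; rewrite /cumul big_mkcond sum3E /= ?addr0 ?add0r.
Qed.

(** By induction: nonnegative proportions of sum 1 make the three pieces tile the half-open
    interval, and [digit] names the piece that contains [t]. *)
Lemma agree_codingP n y (t : R) : 0 <= t < 1 -> agree n y (coding t) <->
  (word_state y n).1.1 <= t < (word_state y n).1.1 + word_weight y n.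
Proof.
move=> t01; elim: n => [|n IH].
  by rewrite /word_weight /= add0r; split=> // _ i.
rewrite agree_codingS IH /word_weight /= /digit.
have := word_weight_ge0 y n; have [s0 s1] := word_state_prob y n.
rewrite /word_weight; move: (word_state y n) s0 s1 => [[lo len] p] /= s0.
rewrite sum3E => s1 len0.
have [c0 c1 c2] := cumulE p.
have q0 := mulr_ge0 len0 (s0 0); have q1 := mulr_ge0 len0 (s0 1).
have q2 := mulr_ge0 len0 (s0 2).
have q3 : len * p 0 + len * p 1 + len * p 2 = len.
  by rewrite -!mulrDr s1 mulr1.
rewrite mulrDr.
(* Comparing [t] with both cut points, for each of the three symbols, leaves only linear arithmetic
   in which the products with [len] are atoms. *)
have [h1|h1] := ltP t (lo + len * p 0);
have [h2|h2] := ltP t (lo + (len * p 0 + len * p 1));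
have [->|->|->] := ord3P (y n); rewrite ?c0 ?c1 ?c2 ?mulr0 ?addr0 ?mulrDr;
  (split=> [[/andP[? ?] e]|/andP[? ?]];
   [by [move/eqP: e | apply/andP; split; lra] |
    by [exfalso; lra | split=> //; apply/andP; split; lra]]).
Qed.

Definition markov_measure : probability Omega R := distribution (@unit_lebesgue R) coding.

Lemma markov_measure_agree n y :
  markov_measure [set x | agree n y x] = (word_weight y n)%:E.
Proof.
rewrite /markov_measure /= /distribution /pushforward /= /unit_lebesgue /mrestr.
(* The interval of the word stays inside [[0, 1[], so restricting Lebesgue measure does not truncate
   it. *)
have [lo_ge0 hi_le1] : 0 <= (word_state y n).1.1 /\
    (word_state y n).1.1 + word_weight y n <= 1.
  elim: n => [|n [IH1 IH2]]; first by rewrite /word_weight /= add0r.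
  move: IH1 IH2; rewrite /word_weight /=.
  have := word_weight_ge0 y n; have [s0 s1] := word_state_prob y n.
  rewrite /word_weight; move: (word_state y n) s0 s1 => [[lo len] p] /= s0.
  rewrite sum3E => s1 len0 lo0 hi1.
  have [c0 c1 c2] := cumulE p.
  have q0 := mulr_ge0 len0 (s0 0); have q1 := mulr_ge0 len0 (s0 1).
  have q2 := mulr_ge0 len0 (s0 2).
  have q3 : len * p 0 + len * p 1 + len * p 2 = len.
    by rewrite -!mulrDr s1 mulr1.
  by have [->|->|->] := ord3P (y n); rewrite ?c0 ?c1 ?c2 ?mulr0 ?addr0 ?mulrDr;
    split; lra.
rewrite (_ : _ `&` _ = [set` `[(word_state y n).1.1,
    (word_state y n).1.1 + word_weight y n[%R]).
  rewrite lebesgue_measure_itv /= lte_fin; case: ltP => h.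
    by rewrite -EFinB addrAC subrr add0r.
  by congr EFin; have := word_weight_ge0 y n; lra.
apply/seteqP; split=> t; rewrite /= !in_itv /=.
  by move=> [h t01]; apply/agree_codingP.
move=> h; have t01 : 0 <= t < 1 by apply/andP; split; lra.
by split=> //; apply/agree_codingP.
Qed.

End markov_coding.

(** * Invariance and approximation by cylinders *)

HB.instance Definition _ :=
  isMeasurableFun.Build _ _ Omega Omega left_shift measurable_left_shift.

Lemma total_probability (R : realType) (d : measure_display)
    (T : measurableType d) (P : probability T R) (F : finType) (X : T -> F)
    (A : set T) : mfinite X -> measurable A ->
  P A = (\sum_a P (A `&` X @^-1` [set a]))%E.
Proof.
move=> mX mA.
have E : A = \bigcup_(a in [set: F]) (A `&` X @^-1` [set a]).
  by apply/seteqP; split=> [x Ax|x [a _ []]//]; exists (X x).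
rewrite [in LHS]E measure_fin_bigcup//; first last.
- by move=> a _; apply: measurableI.
- by move=> a b _ _ [x [[_ /= <-] [_ /= <-]]].
- exact: finite_finset.
rewrite (_ : [set: F] = [set` predT]); last by apply/seteqP; split.
rewrite -(@bigfs _ _ _ _ (index_enum F)) ?index_enum_uniq// => a _.
by rewrite mem_index_enum.
Qed.

Section invariance.
Context (R : realType).
Implicit Types P : probability Omega R.

(** Open sets are stable under intersection and generate the Borel sets; the measure of an open set
    is the limit of those of its [inner] sets, which are finite disjoint unions of cylinders. *)
Lemma eq_probability_agree P1 P2 :
  (forall n y, P1 [set x | agree n y x] = P2 [set x | agree n y x]) ->
  forall A, measurable A -> P1 A = P2 A.
Proof.
move=> P12; apply: (@measure_unique _ _ Omega (@open sequence3) (fun=> setT)) => //.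
- exact: openI.
- by move=> _; exact: openT.
- by rewrite bigcup_const.
- move=> U oU.
  have mi m : measurable (inner U m) := determined_measurable (@determined_inner U m).
  have cv P : P (inner U m) @[m --> \oo] --> P U.
    rewrite -[X in P X](bigcup_inner oU); apply: nondecreasing_cvg_mu => //.
      by rewrite (bigcup_inner oU); exact: measurable_open.
    exact: inner_nondecreasing.
  have E : (fun m => P1 (inner U m)) = (fun m => P2 (inner U m)).
    apply/funext => m.
    have dm := determined_mfinite (@determined_prefix m).
    have -> : inner U m = prefix3 m @^-1` [set` [pred u | `[< inner U m (extend u) >]]].
      apply/seteqP; split=> x.
        by rewrite (@determined_inner U m _ _ (@agree_prefix m x)) => ?; exact/asboolP.
      by rewrite (@determined_inner U m _ _ (@agree_prefix m x)) => /asboolP.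
    rewrite !law_preimage//; congr EFin; apply: eq_bigr => u _.
    rewrite /law (_ : _ @^-1` _ = [set x | agree m (extend u) x]) ?P12//.
    by apply/seteqP; split=> x /agree_extend.
  have L P : limn (fun m => P (inner U m)) = P U by apply: cvg_lim.
  suff : P1 U = P2 U by [].
  by rewrite -L E L.
- suff : (P1 setT < +oo)%E by [].
  by rewrite probability_setT ltry.
Qed.

Definition cons3 (a : 'I_3) (y : Omega) : Omega :=
  fun i => if i is j.+1 then y j else a.

Lemma mfinite_coord n : mfinite (fun x : Omega => x n : 'I_3).
Proof. by apply: (@determined_mfinite n.+1) => x y; apply. Qed.

(** It is enough to compare on cylinders. The shift preimage of a cylinder splits according to the
    symbol that the shift erases, and stationarity of [p0] sums the weights of the pieces. *)
Lemma markov_measure_invariant (p0 : 'I_3 -> R) (Q : 'I_3 -> 'I_3 -> R) :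
  (forall a, 0 <= p0 a) -> \sum_a p0 a = 1 ->
  (forall a b, 0 <= Q a b) -> (forall a, \sum_b Q a b = 1) ->
  (forall b, \sum_a p0 a * Q a b = p0 b) ->
  invariant_measure left_shift (markov_measure p0 Q).
Proof.
move=> p0_ge0 p0_sum Q_ge0 Q_sum p0Q B mB; set P := markov_measure p0 Q.
apply: (@eq_probability_agree (distribution P left_shift) P) => // n y.
rewrite /distribution /pushforward.
have mA m z : measurable ([set x | agree m z x] : set Omega).
  apply: (@determined_measurable m) => x1 x2 x12; apply/propext.
  by split=> h i im; move: (h i im) (x12 i im); congruence.
have mS : measurable (left_shift @^-1` [set x | agree n y x]).
  by have := measurable_left_shift measurableT (mA n y); rewrite setTI.
apply: etrans (total_probability P (@mfinite_coord 0%N) mS) _.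
rewrite (eq_bigr (fun a => (word_weight p0 Q (cons3 a y) n.+1)%:E)); last first.
  move=> a _; rewrite -markov_measure_agree//; congr (P _).
  apply/seteqP; split=> [x [h xa] [|i] im|x h].
  - exact: xa.
  - exact: (h i im).
  by split=> [i /= im|/=]; [exact: (h i.+1) | exact: (h 0%N)].
rewrite sumEFin markov_measure_agree//; congr EFin.
(* For [n = 0] the cylinder is the whole space, and the identity is [p0_sum] instead of
   stationarity. *)
case: n {mS} => [|n].
  rewrite -[RHS]p0_sum; apply: eq_bigr => a _.
  by rewrite word_weightS big_ord0 mulr1.
rewrite [RHS]word_weightS -p0Q mulr_suml; apply: eq_bigr => a _.
by rewrite word_weightS big_ord_recl mulrA.
Qed.

End invariance.

Lemma measurableY (d : measure_display) (T : measurableType d) (A B : set T) :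
  measurable A -> measurable B -> measurable (A `+` B).
Proof. by move=> mA mB; apply: measurableU; exact: measurableD. Qed.

Section approximation.
Context (R : realType) (P : probability Omega R).

Definition approximable (B : set Omega) : Prop := measurable B /\
  forall e : R, 0 < e ->
    exists m C, determined m C /\ (P (B `+` C) < e%:E)%E.

Lemma determined_approximable m C : determined m C -> approximable C.
Proof.
move=> dC; split; first exact: determined_measurable dC.
by move=> e e0; exists m, C; split=> //; rewrite setYK measure0 lte_fin.
Qed.

Lemma approximableC B : approximable B -> approximable (~` B).
Proof.
move=> [mB aB]; split=> [|e /aB[m [C [dC h]]]]; first exact: measurableC.
exists m, (~` C); split; first by move=> x y xy; rewrite /setC /= (dC _ _ xy).
rewrite (_ : _ `+` _ = B `+` C)//.
by apply/seteqP; split=> x; rewrite /setY /=;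
  have [|] := pselect (B x); have [|] := pselect (C x); tauto.
Qed.

Lemma determined_maxU m1 m2 (C1 C2 : set Omega) :
  determined m1 C1 -> determined m2 C2 -> determined (maxn m1 m2) (C1 `|` C2).
Proof.
move=> d1 d2 x y xy; rewrite /setU /=.
rewrite (d1 x y) ?(d2 x y)//; apply: agree_le xy; rewrite ?leq_maxl ?leq_maxr//.
Qed.

Lemma approximableU B1 B2 :
  approximable B1 -> approximable B2 -> approximable (B1 `|` B2).
Proof.
move=> [mB1 aB1] [mB2 aB2]; split=> [|e e0]; first exact: measurableU.
have e20 : 0 < e / 2 by rewrite divr_gt0.
have [m1 [C1 [d1 h1]]] := aB1 _ e20; have [m2 [C2 [d2 h2]]] := aB2 _ e20.
exists (maxn m1 m2), (C1 `|` C2); split; first exact: determined_maxU.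
have mC1 := determined_measurable d1; have mC2 := determined_measurable d2.
rewrite [e]splitr EFinD; apply: le_lt_trans (lteD h1 h2).
apply: le_trans (measureU2 _ _ _).
- apply: le_measure; rewrite ?inE.
  + by apply: measurableY; exact: measurableU.
  + by apply: measurableU; exact: measurableY.
  + by move=> x; rewrite /setY /=; tauto.
- exact: measurableY.
- exact: measurableY.
Qed.

(** By continuity from below some [F n] misses less than [e / 2] of the union; an approximation of
    that [F n] within [e / 2] then serves for the union. *)
Lemma approximable_bigcup_nondecreasing (F : (set Omega)^nat) :
  {homo F : m n / (m <= n)%N >-> (m <= n)%O} ->
  (forall n, approximable (F n)) -> approximable (\bigcup_n F n).
Proof.
move=> ndF aF; have mF n : measurable (F n) by have [] := aF n.
have mU : measurable (\bigcup_n F n) by exact: bigcup_measurable.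
split=> // e e0; have e20 : 0 < e / 2 by rewrite divr_gt0.
have cv : P (F n) @[n --> \oo] --> P (\bigcup_n F n).
  exact: nondecreasing_cvg_mu.
have fU : P (\bigcup_n F n) = (fine (P (\bigcup_n F n)))%:E.
  by rewrite fineK// fin_num_measure.
have [n Fn] : exists n, (P ((\bigcup_n F n) `\` F n) < (e / 2)%:E)%E.
  move: cv; rewrite fU => /fine_cvg/cvgrPdist_lt/(_ _ e20)[n _ /(_ n (leqnn n))].
  rewrite /= => h; exists n.
  have -> : (P ((\bigcup_n F n) `\` F n) = P (\bigcup_n F n) - P (F n))%E.
    rewrite measureD//; last by rewrite ltey_eq fin_num_measure.
    by rewrite (setIidr (_ : F n `<=` _))//; exact: bigcup_sup.
  rewrite fU -[P (F n)]fineK ?fin_num_measure// -EFinB lte_fin.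
  exact: le_lt_trans (ler_norm _) h.
have [m [C [dC h]]] := (aF n).2 _ e20; exists m, C; split=> //.
have mC := determined_measurable dC.
rewrite [e]splitr EFinD; apply: le_lt_trans (lteD Fn h).
apply: le_trans (measureU2 _ _ _).
- apply: le_measure; rewrite ?inE.
  + exact: measurableY.
  + by apply: measurableU; [exact: measurableD|exact: measurableY].
  + move=> x; rewrite /setY /=.
    have : F n x -> (\bigcup_n F n) x by move=> ?; exists n.
    by rewrite /setD /=; have [|] := pselect (F n x); tauto.
- exact: measurableD.
- exact: measurableY.
Qed.

(** The approximable sets form a sigma-algebra containing the open sets; a countable union is
    rewritten as an increasing union of finite ones. *)
Lemma measurable_approximable B : measurable B -> approximable B.
Proof.
apply: smallest_sub => [|U oU]; last first.
  rewrite -(bigcup_inner oU); apply: approximable_bigcup_nondecreasing.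
    exact: inner_nondecreasing.
  by move=> m; apply: determined_approximable; exact: determined_inner.
have a0 : approximable set0 by apply: (@determined_approximable 0%N).
split=> // [A aA|A aA]; first by rewrite setTD; exact: approximableC.
rewrite (_ : \bigcup_k A k = \bigcup_n \big[setU/set0]_(k < n) A k); last first.
  apply/seteqP; split=> [x [k _ Akx]|x [n _]].
    by exists k.+1 => //; rewrite big_ord_recr /=; right.
  by rewrite -bigcup_mkord => -[k _ ?]; exists k.
apply: approximable_bigcup_nondecreasing.
  by move=> m n mn; apply/subsetPset; exact: subset_bigsetU.
by elim=> [|n IH]; rewrite ?big_ord0// big_ord_recr; exact: approximableU.
Qed.

(** Each atom is approximated within [e / k] by a union of cylinders, and [eta x] is a label whose
    approximating set contains [x]. Where [xi] and [eta] differ, [x] lies in one of the [k]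
    symmetric differences. *)
Lemma partition_approximation k (xi : Omega -> 'I_k) (e : R) :
  mfinite xi -> 0 < e ->
  exists m (eta : Omega -> 'I_k),
    determined m eta /\ (P [set x | xi x <> eta x] <= e%:E)%E.
Proof.
move=> mxi e0.
have k0 : 0 < k%:R :> R by rewrite ltr0n; case: k xi mxi => // xi; case: (xi point).
have aa (a : 'I_k) : exists mC : nat * set Omega, determined mC.1 mC.2 /\
    (P (xi @^-1` [set a] `+` mC.2) < (e / k%:R)%:E)%E.
  have [_ /(_ (e / k%:R))[|m [C h]]] := measurable_approximable (mxi a).
    by rewrite divr_gt0.
  by exists (m, C).
have [mC /all_and2[dC PC]] := choice aa.
pose m := \max_a (mC a).1.
have dC' a : determined m (mC a).2.
  by apply: determined_le (dC a); exact: leq_bigmax.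
(* The default label [xi point] does not depend on [x], so [eta] remains determined by [m]
   coordinates. *)
pose eta x := odflt (xi point) [pick a | `[< (mC a).2 x >]].
have deta : determined m eta.
  move=> x y xy; rewrite /eta; congr (odflt _ _); apply: eq_pick => a /=.
  by rewrite (dC' a _ _ xy).
exists m, eta; split=> //; pose D a := xi @^-1` [set a] `+` (mC a).2.
have mD a : measurable (D a).
  by apply: measurableY => //; exact: determined_measurable (dC a).
have mne : measurable [set x | xi x <> eta x].
  have mp := mfinite_pair mxi (determined_mfinite deta).
  exact: (mfinite_preimage [set p | p.1 <> p.2] mp).
have sub : [set x | xi x <> eta x] `<=` \big[setU/set0]_(a < k) D a.
  move=> x /= ne; apply: contrapT => nD; apply: ne.
  have nDa a : ~ D a x.
    by move=> Dax; apply: nD; rewrite (bigD1 a)//=; left.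
  have Cxi : (mC (xi x)).2 x.
    by apply: contrapT => h; apply: (nDa (xi x)); left.
  rewrite /eta; case: pickP => [a /asboolP Ca|/(_ (xi x))]; last first.
    by rewrite asboolT.
  apply: contrapT => /= xia; apply: (nDa a); right; split=> //= xa.
apply: le_trans (le_measure _ _ _ sub) _; rewrite ?inE//.
  exact: bigsetU_measurable.
have sa (r : seq 'I_k) :
    (P (\big[setU/set0]_(a <- r) D a) <= \sum_(a <- r) P (D a))%E.
  elim: r => [|a r IH]; first by rewrite !big_nil measure0.
  rewrite !big_cons; apply: (@le_trans _ _ (P (D a) + P (\big[setU/set0]_(a <- r) D a))%E).
    by apply: measureU2 => //; exact: bigsetU_measurable.
  by rewrite leeD2l.
apply: le_trans (sa _) _.
apply: (@le_trans _ _ (\sum_(a < k) (e / k%:R)%:E)%E).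
  by apply: lee_sum => a _; exact/ltW/PC.
by rewrite sumEFin lee_fin sumr_const card_ord -[leLHS]mulr_natr divfK ?gt_eqF.
Qed.

End approximation.

(** * The variational principle *)

Lemma ln_prod (R : realType) (I : Type) (s : seq I) (f : I -> R) :
  (forall i, 0 < f i) -> ln (\prod_(i <- s) f i) = \sum_(i <- s) ln (f i).
Proof.
move=> f0; elim: s => [|i s IH]; first by rewrite !big_nil ln1.
by rewrite !big_cons lnM ?posrE ?IH// prodr_gt0.
Qed.

(** * Noisy labels *)

Section smoothing.
Context (R : realType) (k : nat) (tau : R).
Hypotheses (k_gt0 : (0 < k)%N) (tau_gt0 : 0 < tau) (tau_lt1 : tau < 1).

Let tau_le1 : 0 <= 1 - tau.
Proof. by rewrite subr_ge0 ltW. Qed.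

(** The probability of reading [c.1] when [c.2] is predicted: the prediction is kept with
    probability [1 - tau] and otherwise replaced by a uniform label. Every entry is positive, as
    Gibbs' inequality requires. *)
Definition smooth (c : 'I_k * 'I_k) : R :=
  (1 - tau) * (c.1 == c.2)%:R + tau / k%:R.

Lemma smooth_ge c : tau / k%:R <= smooth c.
Proof. by rewrite lerDr mulr_ge0 ?ler0n. Qed.

Lemma smooth_gt0 c : 0 < smooth c.
Proof. by apply: lt_le_trans (smooth_ge c); rewrite divr_gt0 ?ltr0n. Qed.

Lemma smooth_sum b : \sum_a smooth (a, b) = 1.
Proof.
rewrite big_split/= -mulr_sumr sumr_const card_ord -[_ *+ k]mulr_natr.
rewrite divfK ?pnatr_eq0 -?lt0n// (bigD1 b)//= big1 ?eqxx; last first.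
  by move=> a /negbTE ->.
by rewrite addr0 mulr1 subrK.
Qed.

Lemma ln_smooth_ge c :
  ln (1 - tau) + (c.1 != c.2)%:R * ln (tau / k%:R) <= ln (smooth c).
Proof.
have tk : 0 < tau / k%:R by rewrite divr_gt0 ?ltr0n.
have t1 : 0 < 1 - tau by rewrite subr_gt0.
case: (eqVneq c.1 c.2) => E; rewrite ?mul0r ?mul1r ?addr0.
  by rewrite ler_ln ?posrE ?smooth_gt0// /smooth E eqxx mulr1 lerDl ltW.
rewrite -lnM ?posrE// ler_ln ?posrE ?smooth_gt0 ?(mulr_gt0 t1 tk)//.
apply: le_trans (smooth_ge c); rewrite ler_piMl ?(ltW tk)// gerBl.
exact: ltW.
Qed.
End smoothing.

(** * Limits of averages *)

Section averages.
Context (R : realType).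
Implicit Types (u : nat -> R) (L K : R).

Lemma cvg_const_over_nat K : (K / n%:R) @[n --> \oo] --> (0 : R).
Proof.
rewrite -(cvg_shiftS (fun n => K / n%:R)).
have h : (K * harmonic n) @[n --> \oo] --> (K * 0 : R).
  by apply: cvgM; [exact: cvg_cst | exact: cvg_harmonic].
by rewrite mulr0 in h.
Qed.

Lemma cvg_linear_over_nat u L K :
  (forall n, `|u n - n%:R * L| <= K) -> (u n / n%:R) @[n --> \oo] --> L.
Proof.
move=> uL; apply/cvgrPdist_le => e e0.
have /cvgrPdist_le/(_ _ e0) := cvg_const_over_nat K.
apply: filter_app; near=> n; rewrite sub0r normrN => h.
have n0 : 0 < n%:R :> R by rewrite ltr0n; near: n; exact: nbhs_infty_gt.
apply: le_trans (le_trans (ler_norm _) h).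
rewrite ler_pdivlMr// -[X in _ * X]gtr0_norm// -normrM mulrBl divfK ?gt_eqF//.
by rewrite distrC mulrC.
Unshelve. all: end_near. Qed.

(* [0 <= L] covers the divergent case, where [lim] is the junk value 0. *)
Lemma lim_over_nat_le u L K : 0 <= L ->
  (forall n, u n <= n%:R * L + K) -> lim (u n / n%:R @[n --> \oo]) <= L.
Proof.
move=> L0 uL.
have [cu|/dvgP ->] := pselect (cvg (u n / n%:R @[n --> \oo])); last exact: L0.
have cv : (L + K / n%:R) @[n --> \oo] --> L.
  have {2}-> : L = L + 0 by rewrite addr0.
  apply: cvgD; first exact: cvg_cst.
  exact: cvg_const_over_nat.
rewrite -[leRHS](cvg_lim _ cv)//; apply: ler_lim => //; first by apply/cvg_ex; exists L.
near=> n; have n0 : 0 < n%:R :> R by rewrite ltr0n; near: n; exact: nbhs_infty_gt.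
by rewrite ler_pdivrMr// mulrDl divfK ?gt_eqF// mulrC.
Unshelve. all: end_near. Qed.
End averages.

Section invariant_law.
Context (R : realType) (mu : probability Omega R).
Hypothesis imu : invariant_measure left_shift mu.

Lemma invariant_iter i B : measurable B -> mu (iter i left_shift @^-1` B) = mu B.
Proof.
elim: i B => [//|i IH] B mB; rewrite -[RHS]imu// -[RHS]IH//; last first.
  by have := measurable_left_shift measurableT mB; rewrite setTI.
Qed.

Lemma law_iter (F : finType) (X : Omega -> F) i a :
  mfinite X -> law mu (fun x => X (iter i left_shift x)) a = law mu X a.
Proof. by move=> mX; rewrite /law -(invariant_iter i (mX a)). Qed.

Lemma mfinite_iter (F : finType) (X : Omega -> F) i :
  mfinite X -> mfinite (fun x => X (iter i left_shift x)).
Proof.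
move=> mX a; rewrite -[X in measurable X]/(iter i left_shift @^-1` (X @^-1` [set a])).
elim: i (X @^-1` [set a]) (mX a) => [//|i IH] B mB /=.
apply: IH (left_shift @^-1` B) _.
by have := measurable_left_shift measurableT mB; rewrite setTI.
Qed.
End invariant_law.

(** * The Parry measure and the variational principle *)

Section parry.
Context (R : realType) (M : 'I_3 -> 'I_3 -> R) (lam : R) (l r : 'I_3 -> R).
Hypotheses (M_gt0 : forall a b, 0 < M a b) (lam_gt0 : 0 < lam).
Hypotheses (l_gt0 : forall a, 0 < l a) (r_gt0 : forall a, 0 < r a).
Hypotheses (Mr : forall a, \sum_b M a b * r b = lam * r a).
Hypotheses (lM : forall b, \sum_a l a * M a b = lam * l b).

(** The products of left and right Perron eigenvectors form the stationary law; conjugating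
    [M / lam] by [r] makes it stochastic. *)
Definition parry_initial a : R := l a * r a / \sum_b l b * r b.
Definition parry_transition a b : R := M a b * r b / (lam * r a).
Definition parry_measure : probability Omega R :=
  markov_measure parry_initial parry_transition.

Lemma parry_norm_gt0 : 0 < \sum_b l b * r b.
Proof. by rewrite sum3E !addr_gt0// mulr_gt0. Qed.

Lemma parry_initial_gt0 a : 0 < parry_initial a.
Proof. by rewrite divr_gt0 ?parry_norm_gt0// mulr_gt0. Qed.

Lemma parry_initial_sum : \sum_a parry_initial a = 1.
Proof. by rewrite -mulr_suml divff// gt_eqF// parry_norm_gt0. Qed.

Lemma parry_transition_gt0 a b : 0 < parry_transition a b.
Proof. by rewrite divr_gt0// mulr_gt0. Qed.

Lemma parry_transition_sum a : \sum_b parry_transition a b = 1.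
Proof. by rewrite -mulr_suml Mr divff// gt_eqF// mulr_gt0. Qed.

Lemma parry_stationary b :
  \sum_a parry_initial a * parry_transition a b = parry_initial b.
Proof.
rewrite (eq_bigr (fun a => l a * M a b * (r b / (lam * \sum_b l b * r b)))).
  rewrite -mulr_suml lM /parry_initial; field.
  by rewrite !gt_eqF ?parry_norm_gt0.
move=> a _; rewrite /parry_initial /parry_transition; field.
by rewrite !gt_eqF ?parry_norm_gt0.
Qed.

Let p_ge0 a : 0 <= parry_initial a := ltW (parry_initial_gt0 a).
Let Q_ge0 a b : 0 <= parry_transition a b := ltW (parry_transition_gt0 a b).

Lemma parry_measure_invariant : invariant_measure left_shift parry_measure.
Proof.
exact: (markov_measure_invariant p_ge0 parry_initial_sum Q_ge0
  parry_transition_sum parry_stationary).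
Qed.

Lemma law_parry_prefix n u : law parry_measure (prefix3 n) u =
  word_weight parry_initial parry_transition (extend u) n.
Proof.
rewrite /law (_ : _ @^-1` _ = [set x | agree n (extend u) x]).
  by rewrite (markov_measure_agree p_ge0 parry_initial_sum Q_ge0
    parry_transition_sum).
by apply/seteqP; split=> x /agree_extend.
Qed.

Lemma parry_weight_gt0 y n :
  0 < word_weight parry_initial parry_transition y n.
Proof.
case: n => [|n]; first by rewrite /word_weight /=.
rewrite word_weightS mulr_gt0 ?parry_initial_gt0// prodr_gt0// => i _.
exact: parry_transition_gt0.
Qed.

(** The factors [r b / r a] of the transitions telescope, leaving boundary terms. A word of [n.+1]
    symbols has [n] transitions. *)
Lemma ln_parry_weight y n :
  ln (word_weight parry_initial parry_transition y n.+1) =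
  (ln (parry_initial (y 0%N)) - ln (r (y 0%N))) + ln (r (y n))
  - n%:R * ln lam + \sum_(i < n) ln (M (y i) (y i.+1)).
Proof.
elim: n => [|n IH].
  by rewrite big_ord0 word_weightS big_ord0 mulr1 mul0r; ring.
have -> : word_weight parry_initial parry_transition y n.+2 =
    word_weight parry_initial parry_transition y n.+1 *
    parry_transition (y n) (y n.+1).
  by rewrite !word_weightS big_ord_recr mulrA.
rewrite lnM ?posrE ?parry_weight_gt0 ?parry_transition_gt0// IH.
rewrite big_ord_recr -(natr1 n) /= /parry_transition.
rewrite ln_div ?posrE ?mulr_gt0// (@lnM _ (M _ _)) ?(@lnM _ lam) ?posrE//; ring.
Qed.

Definition pair01 (x : Omega) : 'I_3 * 'I_3 := (x 0%N, x 1%N).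

Lemma mfinite_pair01 : mfinite pair01.
Proof. exact: (mfinite_pair (@mfinite_coord 0%N) (@mfinite_coord 1%N)). Qed.

(** For [M a b = expR (- beta * eps a b)] this is [beta] times the integral of the potential. *)
Definition mean_log (mu : probability Omega R) : R :=
  \sum_c law mu pair01 c * ln (M c.1 c.2).

(** In [ln_parry_weight] the sum over transitions has mean [n%:R * mean_log mu] by invariance, and
    the boundary terms are bounded independently of [mu] and [n]. *)
Lemma cross_entropy_parry : exists K : R, forall (mu : probability Omega R) n,
  invariant_measure left_shift mu ->
  `| - \sum_u law mu (prefix3 n.+1) u * ln (law parry_measure (prefix3 n.+1) u)
     - n%:R * (ln lam - mean_log mu)| <= K.
Proof.
pose c0 a := ln (parry_initial a) - ln (r a).
pose K1 := \sum_a `|c0 a|; pose K2 := \sum_a `|ln (r a)|.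
have K1P a : `|c0 a| <= K1 by rewrite /K1 (bigD1 a)//= lerDl sumr_ge0.
have K2P a : `|ln (r a)| <= K2 by rewrite /K2 (bigD1 a)//= lerDl sumr_ge0.
exists (K1 + K2) => mu n imu.
have mp := determined_mfinite (@determined_prefix n.+1).
have E : \sum_u law mu (prefix3 n.+1) u *
      ln (law parry_measure (prefix3 n.+1) u) =
    \sum_u law mu (prefix3 n.+1) u * (c0 (extend u 0%N) + ln (r (extend u n)))
    - n%:R * (ln lam - mean_log mu).
  rewrite (eq_bigr (fun u => law mu (prefix3 n.+1) u * (c0 (extend u 0%N) +
      ln (r (extend u n))) - law mu (prefix3 n.+1) u * (n%:R * ln lam) +
      \sum_(i < n) law mu (prefix3 n.+1) u *
        ln (M (extend u i) (extend u i.+1)))); last first.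
    move=> u _; rewrite law_parry_prefix ln_parry_weight -mulr_sumr /c0; ring.
  rewrite big_split/= sumrB -mulr_suml sum_law// mul1r exchange_big/=.
  (* By invariance the pair of symbols at times [i] and [i.+1] has the law of [pair01]. *)
  rewrite [X in _ - _ + X](eq_bigr (fun=> mean_log mu)); last first.
    move=> i _; rewrite /mean_log.
    pose g (u : {ffun 'I_n.+1 -> 'I_3}) := (extend u i : 'I_3, extend u i.+1 : 'I_3).
    rewrite -(expect_comp mu g (fun c => ln (M c.1 c.2)) mp).
    apply: eq_bigr => c _; congr (_ * _).
    rewrite -(law_iter imu i c mfinite_pair01); congr (law _ _ _).
    apply/funext => x; rewrite /g /= /pair01 !iter_left_shift add0n add1n.
    by rewrite !(@agree_prefix n.+1 x)// ltnS// ltnW.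
  by rewrite sumr_const card_ord -[_ *+ n]mulr_natl; ring.
rewrite E opprB addrAC subrr sub0r normrN.
apply: le_trans (ler_norm_sum _ _ _) _.
rewrite -[leRHS]mul1r -(sum_law mu mp) mulr_suml; apply: ler_sum => u _.
rewrite normrM ger0_norm ?law_ge0// ler_wpM2l ?law_ge0//.
by apply: le_trans (ler_normD _ _) _; exact: lerD.
Qed.

Lemma join_entropyE (mu : probability Omega R) k (xi : Omega -> 'I_k) n :
  join_entropy left_shift mu xi n = - \sum_w
    law mu (fun x => [ffun i : 'I_n => xi (iter i left_shift x)]) w *
    ln (law mu (fun x => [ffun i : 'I_n => xi (iter i left_shift x)]) w).
Proof.
rewrite /join_entropy; congr (- _); apply: eq_bigr => w _; rewrite /law.
rewrite (_ : join_atom _ _ _ =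
  (fun x => [ffun i : 'I_n => xi (iter i left_shift x)]) @^-1` [set w])//.
apply/seteqP; split=> [x h|x /= <- i]; last by rewrite ffunE.
by apply/ffunP => i; rewrite ffunE; exact: h.
Qed.

(* Gibbs' inequality against the law on pairs (xi-name, symbol word) under which
   the word is distributed as in the Parry measure and the name is a noisy
   version of the one predicted from the word by an approximation of xi. *)
Lemma join_entropy_le (mu : probability Omega R) k (xi : Omega -> 'I_k) (delta : R) :
  invariant_measure left_shift mu -> measurable_partition xi -> 0 < delta ->
  exists K, forall n, join_entropy left_shift mu xi n <=
    n%:R * (ln lam - mean_log mu + delta) + K.
Proof.
move=> imu mxi delta0.
have k0 : (0 < k)%N by case: k xi mxi => // xi; case: (xi point).
(* Chosen so that [ln (1 - tau)] is exactly [- (delta / 2)]. *)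
pose tau : R := 1 - expR (- (delta / 2)).
have ltau : ln (1 - tau) = - (delta / 2) by rewrite /tau subKr expRK.
have tau1 : tau < 1 by rewrite /tau gtrBl expR_gt0.
have tau0 : 0 < tau by rewrite /tau subr_gt0 expR_lt1 oppr_lt0 divr_gt0.
have ltk : ln (tau / k%:R) <= 0.
  apply: ln_le0; rewrite ler_pdivrMr ?ltr0n// mul1r.
  by apply: (@le_trans _ _ 1); [exact: ltW | rewrite ler1n].
(* Errors of probability at most [e] cost at most [delta / 2]; the summand 1 keeps the denominator
   positive. *)
pose e : R := delta / 2 / (1 - ln (tau / k%:R)).
have e0 : 0 < e by rewrite divr_gt0//; lra.
have [m [eta [deta Peta]]] := partition_approximation mu mxi e0.
have meta := determined_mfinite deta.
have mxe := mfinite_pair mxi meta.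
(* The mean cost of one noisy letter: [delta / 2] for the factor [1 - tau] and [delta / 2] for the
   wrong predictions. *)
have err : delta >= - \sum_c law mu (fun x => (xi x, eta x)) c * ln (smooth tau c).
  rewrite lerNl.
  apply: (@le_trans _ _ (\sum_c law mu (fun x => (xi x, eta x)) c *
      (ln (1 - tau) + (c.1 != c.2)%:R * ln (tau / k%:R)))); last first.
    by apply: ler_sum => c _; rewrite ler_wpM2l ?law_ge0// ln_smooth_ge.
  under eq_bigr do rewrite mulrDr mulrA.
  rewrite big_split/= -!mulr_suml sum_law// mul1r ltau.
  have : \sum_c law mu (fun x => (xi x, eta x)) c * (c.1 != c.2)%:R <= e.
    rewrite -lee_fin; apply: le_trans Peta.
    rewrite (_ : mkset _ = (fun x => (xi x, eta x)) @^-1`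
        [set` [pred c | c.1 != c.2]]); last first.
      by apply/seteqP; split=> x /= /eqP.
    rewrite law_preimage// lee_fin [leRHS]big_mkcond/=.
    by apply: ler_sum => c _; rewrite inE; case: eqP; rewrite ?mulr0 ?mulr1.
  move=> /(ler_wnM2r ltk) h1.
  have h2 : - (delta / 2) <= e * ln (tau / k%:R).
    rewrite /e -mulrA -[leLHS]mulrN1 ler_pM2l; last by rewrite divr_gt0.
    rewrite mulrC ler_pdivlMr; last by lra.
    lra.
  by rewrite [X in - X]splitr opprD lerD2l; exact: le_trans h2 h1.
have [K0 K0P] := cross_entropy_parry.
exists (m%:R * (ln lam - mean_log mu) + K0) => n.
pose W x := [ffun i : 'I_n => xi (iter i left_shift x)].
(* Predicting the letter at time [i < n] uses the coordinates from [i] to [i + m - 1]; the successor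
   matches the word length in [cross_entropy_parry]. *)
pose U := prefix3 (n + m).+1; pose Z x := (W x, U x).
have mU : mfinite U := determined_mfinite (@determined_prefix _).
have mZ : mfinite Z.
  by apply: mfinite_pair => //; apply: mfinite_ffun => i; exact: mfinite_iter.
pose h (i : 'I_n) (z : {ffun 'I_n -> 'I_k} * {ffun 'I_(n + m).+1 -> 'I_3}) :=
  (z.1 i, eta (iter i left_shift (extend z.2))).
pose q z := law parry_measure U z.2 * \prod_i smooth tau (h i z).
have nu0 u : 0 < law parry_measure U u.
  by rewrite law_parry_prefix parry_weight_gt0.
have pr0 z : 0 < \prod_i smooth tau (h i z).
  by apply: prodr_gt0 => i _; exact: smooth_gt0.
have q0 z : 0 < q z by rewrite mulr_gt0.
have q1 : \sum_z q z <= 1.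
  rewrite -(sum_law parry_measure mU) -(pair_bigA _ (fun w u => q (w, u)))/=.
  rewrite exchange_big/=; apply: ler_sum => u _; rewrite /q /= -mulr_sumr.
  (* For a fixed word the letters of the name are independent, so the sum over names is a product of
     sums equal to 1. *)
  rewrite -(bigA_distr_bigA (fun (i : 'I_n) (a : 'I_k) =>
    smooth tau (a, eta (iter i left_shift (extend u)))))/=.
  by rewrite big1 ?mulr1// => i _; exact: smooth_sum.
have := gibbs mu fst mZ q0 q1.
rewrite join_entropyE => /le_trans; apply.
under eq_bigr do rewrite lnM ?posrE ?nu0 ?pr0// mulrDr.
rewrite big_split/= opprD.
rewrite -(expect_comp mu snd (fun u => ln (law parry_measure U u)) mZ).
have := K0P mu (n + m)%N imu; rewrite ler_norml => /andP[_].
rewrite lerBlDr natrD -/U => h1.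
have h2 : - \sum_z law mu Z z * ln (\prod_i smooth tau (h i z)) <= n%:R * delta.
  rewrite (eq_bigr (fun z => \sum_i law mu Z z * ln (smooth tau (h i z)))); last first.
    move=> z _; rewrite -mulr_sumr; congr (_ * _).
    by apply: ln_prod => i; exact: smooth_gt0.
  rewrite exchange_big/= -sumrN mulr_natl -[X in _ *+ X]card_ord -sumr_const.
  apply: ler_sum => i _; apply: le_trans err.
  rewrite -(expect_comp mu (h i) (fun c => ln (smooth tau c)) mZ).
  rewrite (eq_bigr (fun c => law mu (fun x => (xi x, eta x)) c * ln (smooth tau c)))//.
  move=> c _; congr (_ * _); rewrite -(law_iter imu i c mxe); congr (law _ _ _).
  (* The padded word agrees with [x] on all the coordinates that [eta] reads at time [i]. *)
  apply/funext => x; rewrite /h /= ffunE; congr (_, _); apply: deta => j jm.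
  rewrite !iter_left_shift (@agree_prefix (n + m).+1 x)//.
  by have := ltn_ord i; lia.
move: h1 h2; rewrite -[snd \o Z]/U.
move: (\sum_u _) (\sum_z _) => s1 s2; lra.
Qed.

Lemma KS_entropy_le (mu : probability Omega R) :
  invariant_measure left_shift mu -> 0 <= ln lam - mean_log mu ->
  (KS_entropy left_shift mu <= (ln lam - mean_log mu)%:E)%E.
Proof.
move=> imu L0; apply: ge_ereal_sup => _ [k [xi [mxi ->]]]; rewrite lee_fin.
apply/ler_addgt0Pr => delta delta0.
have [K KP] := join_entropy_le imu mxi delta0.
by apply: lim_over_nat_le KP; rewrite addr_ge0// ltW.
Qed.

(** For the partition by the first symbol the names are the words themselves, so the join entropy of
    the Parry measure is the cross entropy of the Parry measure with itself, known up to a bounded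
    error. *)
Lemma KS_entropy_parry_ge :
  ((ln lam - mean_log parry_measure)%:E <= KS_entropy left_shift parry_measure)%E.
Proof.
apply: ereal_sup_ubound; exists 3%N, (fun x : Omega => x 0%N : 'I_3).
split; first exact: mfinite_coord.
congr EFin; apply/esym/cvg_lim => //.
have [K KP] := cross_entropy_parry.
set L := ln lam - _; set H := join_entropy _ _ _.
(* Words of length [n.+1] have [n] transitions, whence the extra [L]; the term [H 0] covers the
   empty word. *)
apply: (@cvg_linear_over_nat _ _ _ (K + `|L| + `|H 0%N|)) => -[|n].
  rewrite mul0r subr0 lerDr addr_ge0//.
  exact: le_trans (normr_ge0 _) (KP _ 0%N parry_measure_invariant).
rewrite -natr1 mulrDl mul1r opprD addrA -[leRHS]addrA.
apply: le_trans (ler_normB _ _) _; apply: lerD; last by rewrite lerDl.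
have := KP _ n parry_measure_invariant; rewrite /H join_entropyE.
rewrite (_ : (fun x => [ffun i => _]) = prefix3 n.+1)//.
by apply/funext => x; apply/ffunP => i; rewrite !ffunE iter_left_shift.
Qed.

Lemma pressure_perron (eps : 'I_3 -> 'I_3 -> R) (beta : R) : 0 <= beta ->
  (forall a b, 0 <= eps a b) -> 1 <= lam ->
  (forall a b, M a b = expR (- beta * eps a b)) ->
  pressure (potential eps) beta = ln lam.
Proof.
move=> beta0 eps0 lam1 ME.
have intE (mu : probability Omega R) :
    (beta%:E * \int[mu]_x (potential eps x)%:E = (mean_log mu)%:E)%E.
  rewrite (expect_integral mu (fun c => - eps c.1 c.2) mfinite_pair01) -EFinM.
  congr EFin; rewrite /mean_log mulr_sumr; apply: eq_bigr => c _.
  by rewrite ME expRK; ring.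
rewrite /pressure.
set S := (X in ereal_sup X); suff -> : ereal_sup S = (ln lam)%:E by [].
apply/eqP; rewrite eq_le; apply/andP; split.
  apply: ge_ereal_sup => _ [mu imu <-]; rewrite intE.
  rewrite -[ln lam](subrK (mean_log mu)) EFinD leeD2r//; apply: KS_entropy_le => //.
  (* The sign condition of [KS_entropy_le] holds because [ln lam >= 0] and [mean_log mu <= 0]. *)
  rewrite subr_ge0; apply: le_trans (ln_ge0 lam1); rewrite sumr_le0// => c _.
  by rewrite mulr_ge0_le0 ?law_ge0// ME expRK mulNr oppr_le0 mulr_ge0.
apply: (@le_trans _ _ (KS_entropy left_shift parry_measure +
    (mean_log parry_measure)%:E)%E).
  rewrite -[ln lam](subrK (mean_log parry_measure)) EFinD leeD2r//.
  exact: KS_entropy_parry_ge.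
rewrite -intE; apply: ereal_sup_ubound; exists parry_measure => //.
exact: parry_measure_invariant.
Qed.

End parry.

(** * The Perron root and its asymptotics *)

Section perron_root.
Context (R : realType).

(** Intermediate value theorem to the right of [Num.sqrt p]. The bound [p < m ^+ 2] makes the third
    coordinate of the eigenvectors positive. *)
Lemma secular_root (p b d t : R) :
  0 < p -> 0 < b -> 0 < d -> 0 < t < 1 ->
  exists2 m, 0 < m & p < m ^+ 2 /\ (m ^+ 2 - p) * (1 + m - t) = m * b + d.
Proof.
move=> p0 b0 d0 /andP[t0 t1].
pose P : {poly R} := ('X^2 - p%:P) * (1 + 'X - t%:P) - 'X * b%:P - d%:P.
have PE x : P.[x] = (x ^+ 2 - p) * (1 + x - t) - x * b - d.
  by rewrite /P !hornerE.
pose m0 := Num.sqrt p.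
have m00 : 0 < m0 by rewrite sqrtr_gt0.
have m02 : m0 ^+ 2 = p by rewrite sqr_sqrtr// ltW.
(* At this point [m1 ^+ 2 - p >= (1 + b + d) * m1], while [1 + m1 - t >= 1] and [m1 >= 1], so the
   left side exceeds [m1 * b + d]. *)
pose m1 := m0 + (1 + b + d).
have Pm0 : P.[m0] < 0.
  rewrite PE m02 subrr mul0r sub0r -opprD oppr_lt0 addr_gt0//.
  exact: mulr_gt0.
have Pm1 : 0 <= P.[m1].
  rewrite PE -m02 /m1; move: m0 m00 {m02 m1 Pm0} => m m_gt0.
  have s0 : 0 < 1 + b + d by lra.
  have h1 : (1 + b + d) * (1 + b + d + m) <= (m + (1 + b + d)) ^+ 2 - m ^+ 2.
    have := mulr_gt0 m_gt0 s0; rewrite !expr2; nra.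
  have T1 : 1 <= m + (1 + b + d) by lra.
  have h2 : (1 + b + d) * (m + (1 + b + d)) <=
      ((m + (1 + b + d)) ^+ 2 - m ^+ 2) * (1 + (m + (1 + b + d)) - t).
    apply: le_trans (_ : _ <= ((m + (1 + b + d)) ^+ 2 - m ^+ 2) * 1) _.
      by rewrite mulr1 [X in _ * X]addrC.
    apply: ler_wpM2l; last by lra.
    by apply: le_trans h1; rewrite mulr_ge0; lra.
  have := mulr_gt0 d0 m_gt0; have := mulr_gt0 d0 s0; nra.
have [||m] := @poly_ivt R P m0 m1.
- by rewrite /m1; lra.
- by rewrite (ltW Pm0).
move=> /andP[m0m _] /rootP Pm.
have {}m0m : m0 < m.
  by rewrite lt_neqAle m0m andbT; apply/eqP => E; move: Pm0; rewrite E Pm ltxx.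
exists m; first exact: lt_trans m0m.
split; first by rewrite -m02 ltr_pXn2r ?nnegrE// ltW// (lt_trans m00).
by move: Pm; rewrite PE => /eqP; rewrite subr_eq0 subr_eq => /eqP ->; ring.
Qed.

Definition vec3 (x y z : R) (a : 'I_3) : R :=
  if a == 0 then x else if a == 1 then y else z.

Lemma ord3_ind (Q : 'I_3 -> Prop) : Q 0 -> Q 1 -> Q 2 -> forall a, Q a.
Proof. by move=> Q0 Q1 Q2 a; have [->|->|->] := ord3P a. Qed.

(* The eigenvectors are the third column and the third row of the adjugate of
   [1 + m - M]. *)
Lemma pressure_secular (eps : 'I_3 -> 'I_3 -> R) (beta : R) :
  eps 0 0 = 0 -> eps 1 1 = 0 ->
  (forall i j : 'I_3, (i, j) <> (0, 0) -> (i, j) <> (1, 1) -> 0 < eps i j) ->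
  0 < beta ->
  let a i j := expR (- beta * eps i j) in
  exists2 m, 0 < m & pressure (potential eps) beta = ln (1 + m) /\
    (m ^+ 2 - a 0 1 * a 1 0) * (1 + m - a 2 2) =
    m * (a 0 2 * a 2 0 + a 1 2 * a 2 1) +
    (a 0 1 * a 1 2 * a 2 0 + a 0 2 * a 1 0 * a 2 1).
Proof.
move=> e11 e22 eps_gt0 beta0 a.
have a_gt0 i j : 0 < a i j by exact: expR_gt0.
have a00 : a 0 0 = 1 by rewrite /a e11 mulr0 expR0.
have a11 : a 1 1 = 1 by rewrite /a e22 mulr0 expR0.
have a22 : 0 < a 2 2 < 1.
  by rewrite a_gt0 expR_lt1 mulNr oppr_lt0 mulr_gt0// eps_gt0.
have [||||m m0 [pm eq_m]] := @secular_root (a 0 1 * a 1 0)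
    (a 0 2 * a 2 0 + a 1 2 * a 2 1)
    (a 0 1 * a 1 2 * a 2 0 + a 0 2 * a 1 0 * a 2 1) (a 2 2); rewrite ?addr_gt0 ?mulr_gt0//.
exists m => //; split=> //.
pose r := vec3 (a 0 1 * a 1 2 + a 0 2 * m) (a 1 0 * a 0 2 + a 1 2 * m)
  (m ^+ 2 - a 0 1 * a 1 0).
pose l := vec3 (a 2 0 * m + a 2 1 * a 1 0) (a 2 1 * m + a 2 0 * a 0 1)
  (m ^+ 2 - a 0 1 * a 1 0).
apply: (@pressure_perron R a (1 + m) l r) => //.
- by rewrite addr_gt0.
- by apply: ord3_ind; rewrite /l /vec3/= ?subr_gt0// addr_gt0// mulr_gt0.
- by apply: ord3_ind; rewrite /r /vec3/= ?subr_gt0// addr_gt0// mulr_gt0.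
(* The first two rows are polynomial identities; the third is the characteristic equation [eq_m]. *)
- apply: ord3_ind; rewrite sum3E /r /vec3/= ?a00 ?a11; [ring|ring|].
  have -> : (1 + m) * (m ^+ 2 - a 0 1 * a 1 0) =
    (m ^+ 2 - a 0 1 * a 1 0) * (1 + m - a 2 2) +
    a 2 2 * (m ^+ 2 - a 0 1 * a 1 0) by ring.
  by rewrite eq_m; ring.
- apply: ord3_ind; rewrite sum3E /l /vec3/= ?a00 ?a11; [ring|ring|].
  have -> : (1 + m) * (m ^+ 2 - a 0 1 * a 1 0) =
    (m ^+ 2 - a 0 1 * a 1 0) * (1 + m - a 2 2) +
    a 2 2 * (m ^+ 2 - a 0 1 * a 1 0) by ring.
  by rewrite eq_m; ring.
- exact: ltW.
- move=> i j; have [[-> ->]|n00] := pselect ((i, j) = (0, 0)); first by rewrite e11.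
  have [[-> ->]|n11] := pselect ((i, j) = (1, 1)); first by rewrite e22.
  exact/ltW/eps_gt0.
- by rewrite lerDl ltW.
Qed.
End perron_root.

(** * Asymptotics of the root *)

Section asymptotics.
Context (R : realType).
Implicit Types (rho r s : R).

Lemma cvg_expR_rate rho r : rho <= r ->
  expR ((rho - r) * beta) @[beta --> +oo] --> ((rho == r)%:R : R).
Proof.
rewrite le_eqVlt => /predU1P[->|rho_r].
  rewrite eqxx subrr; under eq_fun do rewrite mul0r expR0.
  exact: cvg_cst.
rewrite lt_eqF//.
have h : (beta * (r - rho)) @[beta --> +oo] --> +oo.
  by apply: gt0_cvgMly; rewrite ?subr_gt0.
have := @cvg_comp _ _ _ _ _ _ _ _ h (@cvgr_expR R).
suff -> : ((fun x => expR (- x)) \o (fun beta => beta * (r - rho))) =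
  (fun beta => expR ((rho - r) * beta)) by [].
by apply/funext => x /=; congr expR; ring.
Qed.

Lemma cvg_expR_decay r : 0 < r -> expR (- beta * r) @[beta --> +oo] --> (0 : R).
Proof.
move=> r0; have := cvg_expR_rate (ltW r0); rewrite lt_eqF//.
by under eq_fun do rewrite sub0r mulNr -mulrN mulrC.
Qed.

Lemma cvg_invr_pinfty : beta^-1 @[beta --> +oo] --> (0 : R).
Proof.
by apply/(@gtr0_cvgV0 R R _ _ id) => //; exact: nbhs_pinfty_gt.
Qed.

(** Since [C >= 0] forces [B <= x], the number [2 * x - B] is nonnegative and is the square root of
    the discriminant. *)
Lemma quadratic_root (x B C : R) : 0 < x -> 0 <= C -> x ^+ 2 = x * B + C ->
  x = (B + Num.sqrt (B ^+ 2 + 4 * C)) / 2.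
Proof.
move=> x0 C0 xE.
have Bx : B <= x by rewrite -(ler_pM2l x0) -expr2 xE lerDl.
have -> : B ^+ 2 + 4 * C = (2 * x - B) ^+ 2.
  rewrite (_ : C = x ^+ 2 - x * B); last by rewrite xE; ring.
  ring.
rewrite sqrtr_sqr ger0_norm; last by lra.
by field.
Qed.

(* After multiplication by [expR (rho * beta)] the root [m] solves a quadratic
   equation whose coefficients converge. *)
Lemma secular_asymptotics (m : R -> R) (r1 r2 s0 s1 s2 t : R) :
  0 < r1 -> 0 < r2 -> 0 < s0 -> 0 < s1 -> 0 < s2 -> 0 < t ->
  (forall beta, 0 < beta -> 0 < m beta /\
    (m beta ^+ 2 - expR (- beta * s0)) * (1 + m beta - expR (- beta * t)) =
    m beta * (expR (- beta * r1) + expR (- beta * r2)) +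
    (expR (- beta * s1) + expR (- beta * s2))) ->
  m beta @[beta --> +oo] --> (0 : R) /\
  exists rho L, 0 < L /\
    m beta * expR (rho * beta) @[beta --> +oo] --> (L : R).
Proof.
move=> r1_gt0 r2_gt0 s0_gt0 s1_gt0 s2_gt0 t_gt0 mP.
pose b beta := expR (- beta * r1) + expR (- beta * r2).
pose d beta := expR (- beta * s1) + expR (- beta * s2).
pose kap beta := 1 + m beta - expR (- beta * t).
have b0 : b beta @[beta --> +oo] --> (0 : R).
  have h : b beta @[beta --> +oo] --> (0 + 0 : R).
    by apply: cvgD; exact: cvg_expR_decay.
  by rewrite addr0 in h.
have d0 : d beta @[beta --> +oo] --> (0 : R).
  have h : d beta @[beta --> +oo] --> (0 + 0 : R).
    by apply: cvgD; exact: cvg_expR_decay.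
  by rewrite addr0 in h.
have b_ge0 beta : 0 <= b beta by rewrite addr_ge0// expR_ge0.
have d_ge0 beta : 0 <= d beta by rewrite addr_ge0// expR_ge0.
have kap_gt0 beta : 0 < beta -> 0 < kap beta.
  move=> beta0; have [m0 _] := mP _ beta0; rewrite /kap.
  have : expR (- beta * t) < 1 by rewrite expR_lt1 mulNr oppr_lt0 mulr_gt0.
  lra.
(* The limit of [kap] depends on that of [m]; this crude lower bound comes first and yields
   [m_cvg0]. *)
have half : \forall beta \near +oo, 1 / 2 <= kap beta.
  near=> beta.
  have beta0 : 0 < beta by near: beta; exact: nbhs_pinfty_gt.
  have [m0 _] := mP _ beta0.
  have : expR (- beta * t) <= 1 / 2.
    by near: beta; apply: (cvgr_le 0 (cvg_expR_decay t_gt0)); lra.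
  by rewrite /kap; lra.
have m_cvg0 : m beta @[beta --> +oo] --> (0 : R).
  apply/cvgrPdist_lt => e e0.
  have small : \forall beta \near +oo,
      2 * b beta + (expR (- beta * s0) + 2 * d beta) / e < e.
    have h : 2 * b beta + (expR (- beta * s0) + 2 * d beta) / e @[beta --> +oo]
        --> (2 * 0 + (0 + 2 * 0) / e : R).
      apply: cvgD; first by apply: cvgM => //; exact: cvg_cst.
      apply: cvgM; last exact: cvg_cst.
      apply: cvgD; first exact: cvg_expR_decay.
      by apply: cvgM => //; exact: cvg_cst.
    by apply: (cvgr_lt _ h); rewrite mulr0 addr0 mul0r addr0.
  near=> beta.
  have beta0 : 0 < beta by near: beta; exact: nbhs_pinfty_gt.
  have [m0 mE] := mP _ beta0.
  have hk : 1 / 2 <= kap beta by near: beta.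
  have hs : 2 * b beta + (expR (- beta * s0) + 2 * d beta) / e < e by near: beta.
  (* If [m beta >= e], dividing the equation by [m beta] bounds it by the quantity in [hs], which is
     below [e]. *)
  rewrite sub0r normrN gtr0_norm// ltNge; apply/negP => em.
  have k0 := kap_gt0 _ beta0.
  have m2 : m beta ^+ 2 <= m beta * (2 * b beta) + (expR (- beta * s0) + 2 * d beta).
    have c0 : 0 <= m beta * b beta + d beta by rewrite addr_ge0// mulr_ge0// ltW.
    have : (m beta ^+ 2 - expR (- beta * s0)) <= 2 * (m beta * b beta + d beta).
      rewrite -(ler_pM2r k0) mE -/(b beta) -/(d beta).
      by rewrite mulrAC ler_peMl//; lra.
    lra.
  have : m beta <= 2 * b beta + (expR (- beta * s0) + 2 * d beta) / e.
    rewrite -(ler_pM2l m0) -expr2 mulrDr; apply: le_trans m2 _; rewrite lerD2l.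
    rewrite mulrCA ler_peMr// ?addr_ge0 ?expR_ge0 ?mulr_ge0//.
    by rewrite ler_pdivlMr// mul1r.
  lra.
split=> //.
have kap1 : kap beta @[beta --> +oo] --> (1 : R).
  have h : kap beta @[beta --> +oo] --> (1 + 0 - 0 : R).
    apply: cvgB; last exact: cvg_expR_decay.
    by apply: cvgD => //; exact: cvg_cst.
  by rewrite addr0 subr0 in h.
have kapV : (kap beta)^-1 @[beta --> +oo] --> (1 : R).
  have h : (kap beta)^-1 @[beta --> +oo] --> (1^-1 : R) by apply: cvgV.
  by rewrite invr1 in h.
(* Rescaling lowers the decay rates by [rho] in the linear coefficient and by [2 * rho] in the
   constant one; this is the largest [rho] that keeps them all nonnegative. *)
pose rho := Num.min (Num.min r1 r2) (Num.min (s0 / 2) (Num.min (s1 / 2) (s2 / 2))).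
have rho_r1 : rho <= r1 by rewrite /rho !ge_min lexx.
have rho_r2 : rho <= r2 by rewrite /rho !ge_min lexx !orbT.
have rho_s0 : rho <= s0 / 2 by rewrite /rho !ge_min lexx !orbT.
have rho_s1 : rho <= s1 / 2 by rewrite /rho !ge_min lexx !orbT.
have rho_s2 : rho <= s2 / 2 by rewrite /rho !ge_min lexx !orbT.
have rhoE : [|| rho == r1, rho == r2, rho == s0 / 2, rho == s1 / 2 | rho == s2 / 2].
  rewrite /rho /Num.min; do ![case: ifP => _]; rewrite eqxx ?orbT//.
have cv s : rho <= s / 2 -> expR ((2 * rho - s) * beta) @[beta --> +oo] -->
    ((rho == s / 2)%:R : R).
  move=> rho_s; have -> : (rho == s / 2) = (2 * rho == s).
    by rewrite -[RHS](inj_eq (mulIf (_ : 2^-1 != 0 :> R)))// mulrAC divff ?mul1r.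
  by apply: cvg_expR_rate; lra.
pose B beta := (expR ((rho - r1) * beta) + expR ((rho - r2) * beta)) / kap beta.
pose C beta := expR ((2 * rho - s0) * beta) +
  (expR ((2 * rho - s1) * beta) + expR ((2 * rho - s2) * beta)) / kap beta.
pose Boo : R := (rho == r1)%:R + (rho == r2)%:R.
pose Coo : R := (rho == s0 / 2)%:R + ((rho == s1 / 2)%:R + (rho == s2 / 2)%:R).
have B_cvg : B beta @[beta --> +oo] --> Boo.
  rewrite -[Boo]mulr1; apply: cvgM => //.
  by apply: cvgD; exact: cvg_expR_rate.
have C_cvg : C beta @[beta --> +oo] --> Coo.
  rewrite /Coo -[X in _ + X]mulr1; apply: cvgD; first exact: cv.
  by apply: cvgM => //; apply: cvgD; exact: cv.
pose L := (Boo + Num.sqrt (Boo ^+ 2 + 4 * Coo)) / 2.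
exists rho, L; split.
  have Boo0 : 0 <= Boo by rewrite addr_ge0.
  have Coo0 : 0 <= Coo by rewrite !addr_ge0.
  (* The minimum [rho] is attained, so at least one of the five indicators equals 1; this makes [L]
     positive. *)
  have : (0 < Boo) || (0 < Coo).
    move: rhoE; rewrite /Boo /Coo.
    by do 5![case: eqP => _]; rewrite //= => _; apply/orP; by [left; lra | right; lra].
  move=> h; apply: divr_gt0 => //; case/orP : h => [Boo1|Coo1].
    by rewrite ltr_pwDl// sqrtr_ge0.
  by rewrite ltr_wpDl// sqrtr_gt0 ltr_wpDl ?sqr_ge0// mulr_gt0.
have : (B beta + Num.sqrt (B beta ^+ 2 + 4 * C beta)) / 2 @[beta --> +oo] --> L.
  apply: cvgM; last exact: cvg_cst.
  apply: cvgD => //.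
  apply: (@continuous_cvg _ _ _ _ _ (fun beta => B beta ^+ 2 + 4 * C beta) Num.sqrt).
    exact: sqrt_continuous.
  apply: cvgD; last by apply: cvgM => //; exact: cvg_cst.
  by rewrite expr2; under eq_fun do rewrite expr2; exact: cvgM.
(* For positive [beta] the rescaled root is given by the quadratic formula in [B beta] and
   [C beta]. *)
apply: cvg_trans; apply: near_eq_cvg; near=> beta.
have beta0 : 0 < beta by near: beta; exact: nbhs_pinfty_gt.
have [m0 mE] := mP _ beta0; have k0 := kap_gt0 _ beta0.
apply/esym/quadratic_root.
- by rewrite mulr_gt0// expR_gt0.
- by rewrite addr_ge0 ?expR_ge0// divr_ge0 ?(ltW k0)// addr_ge0// expR_ge0.
have E r : expR ((rho - r) * beta) = expR (rho * beta) * expR (- beta * r).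
  by rewrite -expRD; congr expR; ring.
have E2 s : expR ((2 * rho - s) * beta) = expR (rho * beta) ^+ 2 * expR (- beta * s).
  by rewrite -expRM_natl -expRD; congr expR; ring.
rewrite /B /C !E !E2; apply: (mulIf (lt0r_neq0 k0)).
have -> : (m beta * expR (rho * beta)) ^+ 2 * kap beta =
    expR (rho * beta) ^+ 2 * (expR (- beta * s0) * kap beta +
    (m beta ^+ 2 - expR (- beta * s0)) * kap beta) by ring.
rewrite mE; field.
by rewrite gt_eqF.
Unshelve. all: end_near. Qed.
End asymptotics.

(** Apply [ln (1 + y) <= y] to [y = - (x / (1 + x))], for which [1 + y] is the inverse of
    [1 + x]. *)
Lemma ln1D_ge (R : realType) (x : R) : 0 < x -> x / (1 + x) <= ln (1 + x).
Proof.
move=> x0; have x1 : 0 < 1 + x by rewrite addr_gt0.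
rewrite -lerN2 -lnV ?posrE// [X in ln X](_ : (1 + x)^-1 = 1 + - (x / (1 + x))).
  by apply: le_ln1Dx; rewrite ltrN2 ltr_pdivrMr// mul1r ltrDr ltr01.
by field; rewrite gt_eqF.
Qed.

(** The logarithm of [f beta * expR (rho * beta)] converges because [L > 0], so it vanishes after
    division by [beta]. This identifies the rate defined through [lim] with the explicit [rho]. *)
Lemma cvg_pressure_rate (R : realType) (f : R -> R) (rho L : R) : 0 < L ->
  (forall beta, 0 < beta -> 0 < f beta) ->
  f beta * expR (rho * beta) @[beta --> +oo] --> L ->
  beta^-1 * ln (f beta) @[beta --> +oo] --> - rho.
Proof.
move=> L0 f0 fL.
have h : beta^-1 * ln (f beta * expR (rho * beta)) - rho @[beta --> +oo] -->
    0 * ln L - rho.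
  apply: cvgB; last exact: cvg_cst.
  apply: cvgM; first exact: cvg_invr_pinfty.
  exact: (@continuous_cvg _ _ _ _ _ (fun beta => f beta * expR (rho * beta))
    (@ln R) _ (continuous_ln L0)).
rewrite mul0r sub0r in h; apply: cvg_trans h; apply: near_eq_cvg; near=> beta.
have beta0 : 0 < beta by near: beta; exact: nbhs_pinfty_gt.
rewrite lnM ?posrE ?f0 ?expR_gt0// expRK; field.
by rewrite gt_eqF.
Unshelve. all: end_near. Qed.

Theorem proposition7p2 (R : realType) (eps : 'I_3 -> 'I_3 -> R)
    (eps11 : eps 0 0 = 0) (eps22 : eps 1 1 = 0)
    (eps_gt0 : forall i j : 'I_3,
       (i, j) <> (0, 0) -> (i, j) <> (1, 1) -> 0 < eps i j) :
  exists l : R,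
    pressure_prefactor (potential eps) beta @[beta --> +oo] --> l.
Proof.
have ex beta : exists m : R, 0 < beta -> [/\ 0 < m,
    pressure (potential eps) beta = ln (1 + m) &
    (m ^+ 2 - expR (- beta * (eps 0 1 + eps 1 0))) *
      (1 + m - expR (- beta * eps 2 2)) =
    m * (expR (- beta * (eps 0 2 + eps 2 0)) +
         expR (- beta * (eps 1 2 + eps 2 1))) +
    (expR (- beta * (eps 0 1 + eps 1 2 + eps 2 0)) +
     expR (- beta * (eps 0 2 + eps 1 0 + eps 2 1)))].
  (* The value 0 for [beta <= 0] is a placeholder that makes [m] a total function. *)
  have [beta0|] := ltP 0 beta; last by exists 0.
  have [m m0 [pE mE]] := pressure_secular eps11 eps22 eps_gt0 beta0.
  by exists m => _; split=> //; move: mE; rewrite -!expRD -!mulrDr.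
have [m mP] := choice ex.
have [|||||||m_cvg0 [rho [L [L0 mL]]]] := @secular_asymptotics R m
    (eps 0 2 + eps 2 0) (eps 1 2 + eps 2 1) (eps 0 1 + eps 1 0)
    (eps 0 1 + eps 1 2 + eps 2 0) (eps 0 2 + eps 1 0 + eps 2 1) (eps 2 2);
  rewrite ?addr_gt0 ?eps_gt0//.
  by move=> beta /mP[].
have PL : pressure (potential eps) beta * expR (rho * beta) @[beta --> +oo] --> L.
  (* The pressure [ln (1 + m)] lies between [m / (1 + m)] and [m], and both rescaled bounds tend to
     [L]. *)
  have low : m beta * expR (rho * beta) / (1 + m beta) @[beta --> +oo] --> L.
    have h : m beta * expR (rho * beta) / (1 + m beta) @[beta --> +oo] -->
        L / (1 + 0).
      apply: cvgM => //; apply: cvgV; first by rewrite addr0 oner_neq0.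
      by apply: cvgD => //; exact: cvg_cst.
    by rewrite addr0 divr1 in h.
  apply: squeeze_cvgr low mL; near=> beta.
  have beta0 : 0 < beta by near: beta; exact: nbhs_pinfty_gt.
  have [m0 -> _] := mP _ beta0.
  rewrite mulrAC !ler_pM2r ?expR_gt0// ln1D_ge//=.
  by apply: le_ln1Dx; apply: lt_trans m0.
have rate : pressure_rate (potential eps) = rho.
  rewrite /pressure_rate (_ : lim _ = - rho) ?opprK//.
  apply: cvg_lim => //; apply: cvg_pressure_rate PL => // beta beta0.
  by have [m0 -> _] := mP _ beta0; rewrite ln_gt0// ltrDl.
by exists L; rewrite /pressure_prefactor rate.
Unshelve. all: end_near. Qed.
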